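(* A smooth stratified space is a subcartesian space: if $S$ is a smooth stratified space and $C^{\infty}(S)$ is its space of smooth functions, then $S$ with $C^{\infty}(S)$ is a subcartesian differential space.
   Context: Stratified spaces. Let $S$ be a paracompact Hausdorff space (as for all spaces considered, also second countable). A stratification of $S$ is a locally finite partition of $S$ into locally closed subspaces, called strata, such that: (Manifold Condition) every stratum is a smooth manifold in the induced topology; (Frontier Condition) if $M,N$ are strata and $\bar N\cap M\neq\emptyset$, then $M\subset\bar N$. A smooth chart on $S$ is a homeomorphism $\varphi$ of an open set $U\subseteq S$ onto a subspace $\varphi(U)$ of some $\mathbb{R}^n$ such that for every stratum $M$ the image $\varphi(U\cap M)$ is a smooth submanifold of $\mathbb{R}^n$ and $\varphi|U\cap M:U\cap M\to\varphi(U\cap M)$ is smooth. Two charts $\varphi:U\to\mathbb{R}^n$, $\psi:V\to\mathbb{R}^m$ are compatible if every $x\in U\cap V$ has an open neighbourhood $U_x\subseteq U\cap V$ for which there are $N\geq\max(n,m)$, open sets $O,O'\subseteq\mathbb{R}^N$ containing $\varphi(U_x)\times\{0\}$ and $\psi(U_x)\times\{0\}$ respectively, and a diffeomorphism $H:O\to O'$ with $H(\varphi(y),0)=(\psi(y),0)$ for $y\in U_x$. A smooth structure on $S$ is a maximal atlas of compatible smooth charts covering $S$; a smooth stratified space is a stratified space with a smooth structure. A continuous function $f:S\to\mathbb{R}$ is smooth ($f\in C^{\infty}(S)$) if for every $x\in S$ and every chart $\varphi:U\to\mathbb{R}^n$ of the atlas with $x\in U$ there are a neighbourhood $U_x\subseteq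 U$ of $x$ and a smooth $g:\mathbb{R}^n\to\mathbb{R}$ with $f|U_x=g\circ\varphi|U_x$. Subcartesian spaces. A differential structure on a topological space $R$ is a family $C^{\infty}(R)$ of functions $R\to\mathbb{R}$ such that: (i) the sets $f^{-1}((a,b))$, $f\in C^{\infty}(R)$, $a,b\in\mathbb{R}$, form a sub-basis for the topology of $R$; (ii) if $f_1,\dots,f_n\in C^{\infty}(R)$ and $F\in C^{\infty}(\mathbb{R}^n)$ then $F(f_1,\dots,f_n)\in C^{\infty}(R)$; (iii) if $f:R\to\mathbb{R}$ is such that every $x\in R$ has an open neighbourhood $U_x$ and $f_x\in C^{\infty}(R)$ with $f|U_x=f_x|U_x$, then $f\in C^{\infty}(R)$. A differential space is a topological space with a differential structure. A homeomorphism $\varphi:S\to R$ of differential spaces is a diffeomorphism if $f\circ\varphi\in C^{\infty}(S)$ for all $f\in C^{\infty}(R)$ and $h\circ\varphi^{-1}\in C^{\infty}(R)$ for all $h\in C^{\infty}(S)$. A subset $S\subseteq R$ with the subspace topology is a differential subspace with $f\in C^{\infty}(S)$ iff each $x\in S$ has an open neighbourhood $U$ in $R$ and $f_x\in C^{\infty}(R)$ with $f|(S\cap U)=f_x|(S\cap U)$. A subcartesian space is a Hausdorff differential space covered by open sets each of which is diffeomorphic to a differential subspace of some $\mathbb{R}^n$. *)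

(* Defs.v *)
From HB Require Import structures.
From mathcomp Require Import all_boot all_order all_algebra.
From mathcomp Require Import all_classical all_reals all_analysis.

Set Implicit Arguments.
Unset Strict Implicit.
Unset Printing Implicit Defensive.

Import Order.TTheory GRing.Theory Num.Theory.
Import numFieldNormedType.Exports.

Local Open Scope classical_set_scope.
Local Open Scope ring_scope.

Section Topology.
Context {T T' : topologicalType}.

Definition locally_finite (F : set (set T)) :=
  forall x : T, exists2 V, nbhs x V & finite_set [set M | F M /\ M `&` V !=set0].

Definition locally_closed (A : set T) :=
  exists O C, [/\ open O, closed C & A = O `&` C].

Definition paracompact := forall C : set (set T),
  C `<=` open -> cover C id = [set: T] ->
  exists D : set (set T), [/\ D `<=` open, cover D id = [set: T],
    forall V, D V -> exists2 U, C U & V `<=` U & locally_finite D].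

Definition homeo_onto_image (U : set T) (f : T -> T') :=
  [/\ {in U &, injective f}, {within U, continuous f} &
      forall V, open V -> exists2 W, open W & f @` (U `&` V) = f @` U `&` W].

End Topology.
Arguments paracompact : clear implicits.

Definition maximal_for {X : Type} (P : set X -> Prop) (A : set X) :=
  P A /\ forall B, P B -> A `<=` B -> B `<=` A.

Section Euclidean.
Context {R : realType}.

Definition partials n (s : seq 'I_n) (f : 'rV[R]_n -> R) : 'rV[R]_n -> R :=
  foldr (fun i g x => 'D_(delta_mx 0 i) g x) f s.

(* Meaningful for open [O] only.  Total differentiability of all the iterated *)
(* partial derivatives gives their continuity, so this is C^infinity on [O].  *)
Definition smooth_on n (O : set 'rV[R]_n) (f : 'rV[R]_n -> R) :=
  forall s x, O x -> differentiable (partials s f) x.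

Definition smooth_map_on n m (O : set 'rV[R]_n) (H : 'rV[R]_n -> 'rV[R]_m) :=
  forall j, smooth_on O (fun x => H x 0 j).

Definition diffeo_on n (O O' : set 'rV[R]_n) (H : 'rV[R]_n -> 'rV[R]_n) :=
  [/\ open O, open O', set_bij O O' H, smooth_map_on O H &
      exists2 K, smooth_map_on O' K & forall x, O x -> K (H x) = x].

(* The dimension [k] may depend on the connected component. *)
Definition submanifold n (A : set 'rV[R]_n) :=
  forall p, A p -> exists k O O' H, [/\ (k <= n)%N, O p, diffeo_on O O' H &
    H @` (A `&` O) = O' `&` [set y | forall j : 'I_n, (k <= j)%N -> y 0 j = 0]].

End Euclidean.

(* The values of [chart_map] outside [chart_dom] are irrelevant. *)
Record chart (R : realType) (S : Type) := Chart {
  chart_dim : nat;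
  chart_dom : set S;
  chart_map :> S -> 'rV[R]_chart_dim }.

Section Stratified.
Context {R : realType} {S : topologicalType}.
Implicit Types (c : chart R S) (A : set (chart R S)) (M N : set S).

(* c' o c^-1 is smooth; used when [c @` (dom c `&` dom c')] is open. *)
Definition smooth_transition c c' :=
  exists2 h : 'rV[R]_(chart_dim c) -> 'rV[R]_(chart_dim c'),
    smooth_map_on (c @` (chart_dom c `&` chart_dom c')) h &
    forall x, chart_dom c x -> chart_dom c' x -> h (c x) = c' x.

Definition manifold_chart M c :=
  [/\ exists2 V, open V & chart_dom c = M `&` V,
      homeo_onto_image (chart_dom c) c & open (c @` chart_dom c)].

Definition manifold_atlas M A :=
  [/\ A `<=` manifold_chart M, M `<=` \bigcup_(c in A) chart_dom c &
      forall c c', A c -> A c' -> smooth_transition c c'].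

(* Connected components of [M] may have different dimensions.  The Hausdorff  *)
(* and second countability axioms are inherited from the ambient space.       *)
Definition manifold_structure M A := maximal_for (manifold_atlas M) A.

(* [mfd M] is the smooth structure of the stratum [M]. *)
Definition stratification (strata : set (set S)) (mfd : set S -> set (chart R S)) :=
  [/\ partition strata id [set: S],
      locally_finite strata,
      forall M, strata M -> locally_closed M,
      forall M, strata M -> manifold_structure M (mfd M) &
      forall M N, strata M -> strata N ->
        closure N `&` M !=set0 -> M `<=` closure N].

(* Since the domain of a chart [k] of the stratum [M] lies in [M], the        *)
(* transitions from [k] to [c] express [c] restricted to [M] in the           *)
(* coordinates [k].                                                           *)
Definition smooth_chart (strata : set (set S)) (mfd : set S -> set (chart R S)) c :=
  [/\ open (chart_dom c), homeo_onto_image (chart_dom c) c &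
      forall M, strata M -> submanifold (c @` (chart_dom c `&` M)) /\
                            forall k, mfd M k -> smooth_transition k c].

(* For n <= N, [v *m pid_mx n : 'rV_N] is (v, 0). *)
Definition compatible c c' :=
  forall x, chart_dom c x -> chart_dom c' x ->
  exists (V : set S) (N : nat) (O O' : set 'rV[R]_N) (H : 'rV[R]_N -> 'rV[R]_N),
  [/\ [/\ open V, V x & V `<=` chart_dom c `&` chart_dom c'],
      (maxn (chart_dim c) (chart_dim c') <= N)%N,
      (forall y, V y -> O (c y *m pid_mx (chart_dim c))) /\
      (forall y, V y -> O' (c' y *m pid_mx (chart_dim c'))),
      diffeo_on O O' H &
      forall y, V y ->
        H (c y *m pid_mx (chart_dim c)) = c' y *m pid_mx (chart_dim c')].

Definition smooth_atlas strata mfd A :=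
  [/\ A `<=` smooth_chart strata mfd,
      \bigcup_(c in A) chart_dom c = [set: S] &
      forall c c', A c -> A c' -> compatible c c'].

Definition smooth_structure strata mfd A := maximal_for (smooth_atlas strata mfd) A.

Definition smooth_functions A : set (S -> R) :=
  [set f | continuous f /\
    forall c x, A c -> chart_dom c x ->
    exists (V : set S) (g : 'rV[R]_(chart_dim c) -> R),
      [/\ nbhs x V, V `<=` chart_dom c, smooth_on setT g &
          forall y, V y -> f y = g (c y)]].

End Stratified.

Section DifferentialSpaces.
Context {R : realType}.

Definition differential_structure (T : topologicalType) (C : set (T -> R)) :=
  [/\ basis (finI_from
        [set O | exists f a b, C f /\ O = f @^-1` `]a, b[%classic] id),
      forall n (f : 'I_n -> T -> R) (F : 'rV[R]_n -> R),
        (forall i, C (f i)) -> smooth_on setT F ->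
        C (fun x => F (\row_i f i x)) &
      forall f : T -> R,
        (forall x, exists (U : set T) (fx : T -> R),
          [/\ open U, U x, C fx & forall y, U y -> f y = fx y]) -> C f].

Definition diffeomorphic (T T' : topologicalType)
    (C : set (T -> R)) (C' : set (T' -> R)) :=
  exists (phi : T -> T') (psi : T' -> T),
  [/\ cancel phi psi /\ cancel psi phi,
      continuous phi /\ continuous psi,
      forall f, C' f -> C (f \o phi) &
      forall h, C h -> C' (h \o psi)].

Definition diff_subspace (T : topologicalType) (C : set (T -> R)) (A : set T) :
    set (set_type A -> R) :=
  [set f | forall x : set_type A, exists (U : set T) (fx : T -> R),
    [/\ open U, U (set_val x), C fx &
        forall y : set_type A, U (set_val y) -> f y = fx (set_val y)]].
Arguments diff_subspace {T} C A.

Definition subcartesian (T : topologicalType) (C : set (T -> R)) :=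
  [/\ hausdorff_space T, differential_structure C &
      forall x : T, exists (U : set T) (n : nat) (A : set 'rV[R]_n),
        [/\ open U, U x &
            diffeomorphic (diff_subspace C U)
                          (diff_subspace [set g | smooth_on setT g] A)]].

End DifferentialSpaces.

(* Main.v *)
Require Import Defs.
From mathcomp Require Import all_boot all_order all_algebra.
From mathcomp Require Import all_classical all_reals all_analysis.
From mathcomp Require Import ring lra.

(** Every property of [smooth_functions] is checked in charts, so the proof
rests on two facts that move functions between [S] and the Euclidean spaces.

Descent ([smooth_transfer], [smooth_functionsP]): to be smooth it is enough that
a function is, near each point, of the form [g \o c] for a single chart [c] of
the atlas and a globally smooth [g].  Indeed, if [c'] is another chart, the
compatibility diffeomorphism [H] of the ambient space sends [(c' y, 0)] to
[(c y, 0)], so [g (c y)] is the value at [c' y] of the smooth function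
[z |-> g (pr (H (z, 0)))].  The latter lives only on an open set, and a cutoff
makes it global.

Extension ([smooth_functions_extension]): near [x], each [g \o c] coincides with
a smooth function on [S] that vanishes off a prescribed neighbourhood of [x].
The extension by zero of a function cut off in [c] has to be continuous on
[S].  The space [S] need not be locally compact (take an open half plane with
one boundary point), so a compact support in the chart does not give a closed
support in [S]; instead one shrinks the neighbourhood using that a paracompact
Hausdorff space is regular ([paracompact_regular]).

With [g = 1], extension provides bump functions, hence the sub-basis axiom.
Stability under composition and locality follow from descent.  Finally a chart
[c] is a diffeomorphism of its domain onto its image: extension pulls smooth
functions back along [c], and the local expressions [f = g \o c] push them
forward.

The calculus needed on row vectors is that smooth functions on an open set are
stable under sums, products and composition, and that cutoffs exist.  Stability
is proved in one go: the closure of a family under all these operations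
contains its own partial derivatives as soon as it contains those of the family
([smooth_closureP]).  Cutoffs are built
from the flat function [exp (- 1 / t)]. *)

Set Implicit Arguments.
Unset Strict Implicit.
Unset Printing Implicit Defensive.

Import Order.TTheory GRing.Theory Num.Theory.
Import numFieldNormedType.Exports.

Local Open Scope classical_set_scope.
Local Open Scope ring_scope.

(** * Derivatives of functions of several variables *)

Section Locality.
Context {K : numFieldType} {V W : normedModType K}.

Lemma near_eq_differentiable (f g : V -> W) (x : V) :
  {near x, f =1 g} -> differentiable f x -> differentiable g x.
Proof.
move=> fg df; have gx : g x = f x by rewrite (nbhs_singleton fg).
have gE : g \o shift x = cst (g x) + 'd f x +o_ 0 id.
  have /eqaddoP/= fo := diff_locally df.
  apply/eqaddoP => e e0.
  have fgx : \forall h \near (0 : V), f (h + x) = g (h + x).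
    by move: fg; rewrite (near_shift 0) subr0.
  near=> h; rewrite gx.
  have -> : (g \o shift x - (cst (f x) + 'd f x)) h =
            (f \o shift x - (cst (f x) + 'd f x)) h.
    by rewrite !fctE /=; congr (_ - _); rewrite (near fgx).
  by near: h; exact: fo.
have dgE := diff_unique (diff_continuous df) gE.
by apply/diff_locallyP; rewrite dgE; split => //; exact: diff_continuous.
Unshelve. all: by end_near. Qed.

End Locality.

Section RowVectors.
Context {R : realType} {n m : nat}.
Implicit Types H : 'rV[R]_n -> 'rV[R]_m.

Lemma row_map_sum H :
  H = \sum_(j < m) (fun x => H x 0 j *: delta_mx 0 j).
Proof. by apply/funext => x; rewrite fct_sumE; exact: row_sum_delta. Qed.

Lemma differentiable_row H x :
  (forall j, differentiable (fun y => H y 0 j) x) -> differentiable H x.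
Proof.
move=> dH; rewrite (row_map_sum H); apply: differentiable_sum => j.
exact: (@differentiableZl _ _ _ (fun y => H y 0 j)).
Qed.

(** The chain rule in coordinates. *)
Lemma derive_comp_row (b : 'rV[R]_m -> R) H x v :
  differentiable b (H x) -> (forall j, differentiable (fun y => H y 0 j) x) ->
  'D_v (fun y => b (H y)) x =
  \sum_(j < m) 'D_(delta_mx 0 j) b (H x) * 'D_v (fun y => H y 0 j) x.
Proof.
move=> db dHj; have dH := differentiable_row dHj.
rewrite deriveE; last exact: (@differentiable_comp _ _ _ _ H b).
rewrite (_ : (fun y => b (H y)) = b \o H)// diff_comp//=.
rewrite -(deriveE v dH).
rewrite [in LHS](row_sum_delta ('D_v H x)) linear_sum; apply: eq_bigr => j _.
rewrite linearZ/= derive_mx ?mxE; last exact: diff_derivable.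
rewrite -(deriveE (delta_mx 0 j) db).
by rewrite mulrC.
Qed.

End RowVectors.

Lemma derive_coord {R : realType} n (v x : 'rV[R]_n) j :
  'D_v (fun y : 'rV[R]_n => y 0 j) x = v 0 j.
Proof.
have := @derive_mx R _ 1 n id x v (@derivable_id _ _ _ _).
by rewrite derive_id => /rowP/(_ j); rewrite [in RHS]mxE.
Qed.

(** * The algebra of smooth functions *)

Section Closure.
Context {R : realType}.

Lemma smooth_on_derive n (O : set 'rV[R]_n) f i :
  smooth_on O f -> smooth_on O ('D_(delta_mx 0 i) f).
Proof.
by move=> fO s x Ox; have := fO (rcons s i) x Ox; rewrite /partials foldr_rcons.
Qed.

Lemma smooth_on_differentiable n (O : set 'rV[R]_n) f x :
  smooth_on O f -> O x -> differentiable f x.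
Proof. by move=> fO; exact: (fO [::]). Qed.

(** Smoothness is the greatest property that entails differentiability and is
inherited by partial derivatives; this form avoids any induction on the order of
differentiation. *)
Lemma smooth_on_coinduction n (O : set 'rV[R]_n) (P : set ('rV[R]_n -> R)) :
  (forall f, P f -> (forall x, O x -> differentiable f x) /\
                    forall i, P ('D_(delta_mx 0 i) f)) ->
  P `<=` smooth_on O.
Proof.
move=> PD f Pf s; suff : P (partials s f) by move=> /PD[].
by elim: s => //= i s /PD[_]; exact.
Qed.

(** The terms that differentiation produces from members of [B].  Composition is
included because the chain rule creates factors [b' \o H]; equality on [O] is
included because the rules of calculus hold on [O] only. *)
Inductive smooth_closure n (O : set 'rV[R]_n) (B : set ('rV[R]_n -> R)) :
    ('rV[R]_n -> R) -> Prop :=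
| closure_base f : B f -> smooth_closure O B f
| closure_cst a : smooth_closure O B (cst a)
| closureD f g : smooth_closure O B f -> smooth_closure O B g ->
    smooth_closure O B (f + g)
| closureM f g : smooth_closure O B f -> smooth_closure O B g ->
    smooth_closure O B (f * g)
| closure_comp m (O' : set 'rV[R]_m) b (H : 'rV[R]_n -> 'rV[R]_m) :
    smooth_on O' b -> (forall x, O x -> O' (H x)) ->
    (forall j, smooth_closure O B (fun x => H x 0 j)) ->
    smooth_closure O B (fun x => b (H x))
| closure_eq_on f g : (forall x, O x -> f x = g x) ->
    smooth_closure O B f -> smooth_closure O B g.

Lemma closure_sum n (O : set 'rV[R]_n) B m (F : 'I_m -> 'rV[R]_n -> R) :
  (forall j, smooth_closure O B (F j)) -> smooth_closure O B (\sum_(j < m) F j).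
Proof.
by move=> FB; elim/big_ind : _ => //; [exact: closure_cst|exact: closureD].
Qed.

(** By the sum, product and chain rules, a partial derivative of a term is again
a term as soon as this is so for the members of [B]; coinduction applies. *)
Lemma smooth_closureP n (O : set 'rV[R]_n) B : open O ->
  (forall f, B f -> (forall x, O x -> differentiable f x) /\
                    forall i, smooth_closure O B ('D_(delta_mx 0 i) f)) ->
  smooth_closure O B `<=` smooth_on O.
Proof.
move=> oO BD; apply: smooth_on_coinduction => f.
elim=> {f} [|a|f g cf [df Df] cg [dg Dg]|f g cf [df Df] cg [dg Dg]
           |m O' b H bO' HO cH IH|f g fg cf [df Df]].
- exact: BD.
- split=> [x _|i]; first exact: differentiable_cst.
  rewrite (_ : 'D_ _ _ = cst 0); first exact: closure_cst.
  by apply/funext => x; rewrite derive_cst.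
- split=> [x Ox|i]; first by apply: differentiableD; [exact: df|exact: dg].
  apply: closure_eq_on (closureD (Df i) (Dg i)) => x Ox.
  by rewrite deriveD//; apply: diff_derivable; [exact: df|exact: dg].
- split=> [x Ox|i]; first by apply: differentiableM; [exact: df|exact: dg].
  apply: closure_eq_on (closureD (closureM cf (Dg i)) (closureM cg (Df i))).
  move=> x Ox; rewrite deriveM//; apply: diff_derivable; [exact: df|exact: dg].
- have dH j x : O x -> differentiable (fun y => H y 0 j) x.
    by case: (IH j) => + _; apply.
  have db x : O x -> differentiable b (H x).
    by move=> /HO; exact: smooth_on_differentiable.
  split=> [x Ox|i].
    apply: (@differentiable_comp _ _ _ _ H b); last exact: db.
    by apply: differentiable_row => j; exact: dH.
  pose F j : 'rV_n -> R := (fun x => 'D_(delta_mx 0 j) b (H x)) *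
    'D_(delta_mx 0 i) (fun y => H y 0 j).
  apply: (@closure_eq_on _ _ _ (\sum_(j < m) F j)) => [x Ox|].
    by rewrite derive_comp_row ?fct_sumE//; [exact: db|move=> j; exact: dH].
  apply: closure_sum => j; apply: closureM; last exact: (IH j).2.
  apply: (closure_comp (b := 'D_(delta_mx 0 j) b) _ HO cH).
  exact: smooth_on_derive.
- have nfg x : O x -> {near x, f =1 g}.
    by move=> Ox; apply: filterS (open_nbhs_nbhs (conj oO Ox)).
  split=> [x Ox|i]; first exact: near_eq_differentiable (nfg x Ox) (df x Ox).
  by apply: closure_eq_on (Df i) => x Ox; exact/near_eq_derive/nfg.
Qed.

Section Algebra.
Context {n : nat} {O : set 'rV[R]_n} (oO : open O).

Let closure_smooth : smooth_closure O (smooth_on O) `<=` smooth_on O.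
Proof.
apply: smooth_closureP => // f fO; split=> [x|i].
  exact: smooth_on_differentiable.
exact/closure_base/smooth_on_derive.
Qed.

Lemma smooth_on_cst a : smooth_on O (cst a).
Proof. exact/closure_smooth/closure_cst. Qed.

Lemma smooth_onD f g : smooth_on O f -> smooth_on O g -> smooth_on O (f + g).
Proof. by move=> fO gO; apply/closure_smooth/closureD; exact: closure_base. Qed.

Lemma smooth_onM f g : smooth_on O f -> smooth_on O g -> smooth_on O (f * g).
Proof. by move=> fO gO; apply/closure_smooth/closureM; exact: closure_base. Qed.

Lemma smooth_on_sum m (F : 'I_m -> 'rV[R]_n -> R) :
  (forall j, smooth_on O (F j)) -> smooth_on O (\sum_(j < m) F j).
Proof.
by move=> FO; apply/closure_smooth/closure_sum => j; exact: closure_base.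
Qed.

Lemma smooth_on_comp m (O' : set 'rV[R]_m) b (H : 'rV[R]_n -> 'rV[R]_m) :
  smooth_on O' b -> (forall x, O x -> O' (H x)) -> smooth_map_on O H ->
  smooth_on O (fun x => b (H x)).
Proof.
move=> bO' HO HS; apply/closure_smooth/(closure_comp bO' HO) => j.
exact: closure_base.
Qed.

Lemma eq_smooth_on f g : (forall x, O x -> f x = g x) ->
  smooth_on O f -> smooth_on O g.
Proof. by move=> fg fO; apply/closure_smooth/(closure_eq_on fg)/closure_base. Qed.

Lemma smooth_on_coord j : smooth_on O (fun x => x 0 j).
Proof.
pose B : set ('rV[R]_n -> R) := [set fun x : 'rV[R]_n => x 0 j].
apply: (@smooth_closureP _ _ B) => //; last exact: closure_base.
move=> _ ->; split=> [x _|i]; first exact: differentiable_coord.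
have -> : 'D_(delta_mx 0 i) (fun x : 'rV[R]_n => x 0 j) =
    cst ((delta_mx 0 i : 'rV[R]_n) 0 j); last exact: closure_cst.
by apply/funext => x; exact: derive_coord.
Qed.

Lemma smooth_on_mulmx m (A : 'M[R]_(n, m)) : smooth_map_on O (mulmx^~ A).
Proof.
pose X k : 'rV[R]_n -> R := fun x => x 0 k.
move=> j; rewrite (_ : (fun _ => _) = \sum_(k < n) X k * cst (A k j)).
  apply: smooth_on_sum => k.
  by apply: smooth_onM; [exact: smooth_on_coord|exact: smooth_on_cst].
by apply/funext => x; rewrite mxE fct_sumE.
Qed.

End Algebra.

Lemma smooth_onS n (O O' : set 'rV[R]_n) f : O' `<=` O ->
  smooth_on O f -> smooth_on O' f.
Proof. by move=> O'O fO s x /O'O; exact: fO. Qed.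

Lemma smooth_on_union n (O O' : set 'rV[R]_n) f :
  smooth_on O f -> smooth_on O' f -> smooth_on (O `|` O') f.
Proof. by move=> fO fO' s x [|]; [exact: fO|exact: fO']. Qed.

End Closure.

(** * Cutoff functions *)

Section Flat.
Context {R : realType}.
Implicit Types t : R.

(** The functions [t^-k e^(-1/t)], extended by zero.  The powers of [1/t] are
carried along so that the family is stable under differentiation. *)
Definition flat (k : nat) t : R := if 0 < t then t^-1 ^+ k * expR (- t^-1) else 0.

(** The exponential series gives [e^u >= u^(k+2) / (k+2)!], used at [u = 1/t]. *)
Lemma flat_quadratic k t : `|flat k t| <= (k.+2)`!%:R * t ^+ 2.
Proof.
rewrite /flat; case: ifPn => [t0|_]; last first.
  by rewrite normr0 mulr_ge0// sqr_ge0.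
have u0 : 0 < t^-1 by rewrite invr_gt0.
rewrite ger0_norm; last by rewrite mulr_ge0 ?expR_ge0// exprn_ge0// ltW.
have fact0 : 0 < (k.+2)`!%:R :> R by rewrite ltr0n fact_gt0.
have -> : t^-1 ^+ k = t^-1 ^+ k.+2 * t ^+ 2.
  by rewrite !exprS expr0; field; rewrite gt_eqF.
rewrite -mulrA mulrCA mulrC ler_wpM2r ?sqr_ge0// expRN ler_pdivrMr ?expR_gt0//.
rewrite mulrC -ler_pdivrMr//.
by apply: le_trans (expR_ge1Dxn k.+1 (ltW u0)); rewrite lerDr.
Qed.

Lemma is_derive0_quadratic (f : R -> R) C :
  (forall t, `|f t| <= C * t ^+ 2) -> is_derive (0 : R) (1 : R) f 0.
Proof.
move=> fC.
have f0 : f 0 = 0.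
  by apply/eqP; rewrite -normr_le0 (le_trans (fC 0))// expr0n mulr0.
have fcvg : h^-1 *: (f (h *: 1 + 0) - f 0) @[h --> 0^'] --> (0 : R).
  apply/norm_cvg0P; apply: (@squeeze_cvgr _ _ _ _ (cst 0) (fun h => C * `|h|)).
  - near=> h; rewrite normr_ge0/= f0 subr0 addr0 [h *: 1]mulr1 normrZ normfV.
    have h0 : h != 0 by near: h; exact: nbhs_dnbhs_neq.
    rewrite mulrC ler_pdivrMr ?normr_gt0// (le_trans (fC h))//.
    by rewrite -mulrA -normrM ger0_norm// -expr2 sqr_ge0.
  - exact: cvg_cst.
  - rewrite -[X in _ --> X](mulr0 C); apply: cvgM; first exact: cvg_cst.
    rewrite -[X in _ --> X](@normr0 _ R); apply: cvg_norm; exact: nbhs_dnbhs.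
by apply: DeriveDef; [apply/cvg_ex; exists 0|exact: cvg_lim].
Unshelve. all: by end_near. Qed.

(** Only [t = 0] is not covered by the rules of calculus; there the quadratic
bound forces the derivative to vanish. *)
Lemma is_derive_flat k t :
  is_derive t (1 : R) (flat k) (flat k.+2 t - k%:R * flat k.+1 t).
Proof.
have [t0|t0|->] := ltgtP t 0.
- apply: (@near_eq_is_derive _ _ _ (cst 0)).
    near=> s; rewrite /flat ltNge ltW//; near: s; exact: lt_nbhsl.
  by rewrite /flat ltNge ltW//= mulr0 subr0; exact: is_derive_cst.
- apply: (@near_eq_is_derive _ _ _ (fun s : R => s^-1 ^+ k * expR (- s^-1))).
    near=> s; rewrite /flat ifT//; near: s; exact: lt_nbhsr.
  have dV := is_deriveV (lt0r_neq0 t0) (is_derive_id t (1 : R)).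
  have dX := is_deriveX k dV.
  have dE := @is_derive1_comp R expR (fun s => - s^-1) t _ _
    (is_derive_expR _) (is_deriveN dV).
  have dM := is_deriveM dX dE; rewrite /= !fctE in dM.
  apply: (is_derive_eq dM).
  rewrite /flat t0 /= /GRing.scale/= -exprVn.
  by case: k {dX dM} => [|k] /=; rewrite !exprS ?expr0; ring.
- rewrite /flat ltxx mulr0 subr0; exact: is_derive0_quadratic (flat_quadratic k).
Unshelve. all: by end_near. Qed.


Lemma differentiable_flat k t : differentiable (flat k) t.
Proof. by apply/derivable1_diffP; have [] := is_derive_flat k t. Qed.

(** The functions [flat k] of the coordinate of a 1-dimensional vector have
partial derivatives that are combinations of such functions, so
[smooth_closureP] applies to this family; composition with [f] does the rest. *)
Lemma smooth_on_flat n (O : set 'rV[R]_n) f : open O ->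
  smooth_on O f -> smooth_on O (fun x => flat 0 (f x)).
Proof.
move=> oO fO; pose fl k : 'rV[R]_1 -> R := fun y => flat k (y 0 0).
suff flS : smooth_on setT (fl 0).
  rewrite (_ : (fun _ => _) = fun x => fl 0 (\row_(_ < 1) f x)).
    apply: (smooth_on_comp oO flS) => // j.
    by apply: eq_smooth_on fO => // x _; rewrite mxE.
  by apply/funext => x; rewrite /fl mxE.
apply: (@smooth_closureP _ _ _ (range fl)); first exact: openT.
  move=> _ [k _ <-]; have dfl x : differentiable (fl k) x.
    apply: (@differentiable_comp _ _ _ _ (fun y : 'rV[R]_1 => y 0 0) (flat k)).
      exact: differentiable_coord.
    exact: differentiable_flat.
  split=> [x _|i]; first exact: dfl.
  pose df := cst ((delta_mx 0 i : 'rV[R]_1) 0 0) *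
    (fl k.+2 + cst (- k%:R) * fl k.+1).
  rewrite (_ : 'D_ _ _ = df).
    apply: closureM; first exact: closure_cst.
    apply: closureD; first by apply: closure_base; exists k.+2.
    apply: closureM; first exact: closure_cst.
    by apply: closure_base; exists k.+1.
  apply/funext => x; rewrite deriveE; last exact: dfl.
  rewrite (_ : fl k = flat k \o (fun y : 'rV[R]_1 => y 0 0))// diff_comp//=.
  - rewrite diff1E; last exact: differentiable_flat.
    rewrite -deriveE; last exact: differentiable_coord.
    rewrite derive_coord derive1E; have [_ ->] := is_derive_flat k (x 0 0).
    by rewrite /df !fctE mulNr.
  - exact: differentiable_coord.
  - exact: differentiable_flat.
by apply: closure_base; exists 0%N.
Qed.

(** A smooth step down from 1 to 0 obtained by composing [flat 0] with itself, so
that no quotient has to be differentiated: for [t <= 0] the inner function is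
[0], and for [t >= 1] the argument of the outer one is not positive. *)
Definition plateau t : R := expR 1 * flat 0 (1 - expR 1 * flat 0 t).

Lemma plateau_le0 t : t <= 0 -> plateau t = 1.
Proof.
move=> t0; rewrite /plateau {2}/flat ltNge t0 mulr0 subr0 /flat ltr01 mul1r invr1.
by rewrite -expRD subrr expR0.
Qed.

Lemma plateau_ge1 t : 1 <= t -> plateau t = 0.
Proof.
move=> t1; have t0 : 0 < t by exact: lt_le_trans t1.
suff et : 1 <= expR 1 * flat 0 t.
  by rewrite /plateau {1}/flat subr_gt0 ltNge et mulr0.
rewrite /flat t0 mul1r -expRD -[leLHS]expR0 ler_expR subr_ge0.
by rewrite invf_le1.
Qed.

Lemma smooth_on_plateau n (O : set 'rV[R]_n) f : open O ->
  smooth_on O f -> smooth_on O (fun x => plateau (f x)).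
Proof.
move=> oO fO; pose g x := 1 - expR 1 * flat 0 (f x).
have gO : smooth_on O g.
  have := smooth_onM oO (smooth_on_cst oO (- expR 1)) (smooth_on_flat oO fO).
  move=> /(smooth_onD oO (smooth_on_cst oO 1)); apply: eq_smooth_on => // x _.
  by rewrite /g !fctE mulNr.
have := smooth_onM oO (smooth_on_cst oO (expR 1)) (smooth_on_flat oO gO).
exact: eq_smooth_on.
Qed.

End Flat.

Section Cutoff.
Context {R : realType} {n : nat}.
Implicit Types (p : 'rV[R]_n) (O : set 'rV[R]_n).

(** The plateau is applied to a quadratic function that is negative at [p] and
exceeds 1 off a ball contained in [O]. *)
Lemma exists_bump p O : open O -> O p ->
  exists (chi : 'rV[R]_n -> R) (C : set 'rV[R]_n),
  [/\ smooth_on setT chi, closed C, C `<=` O, (forall x, ~ C x -> chi x = 0) &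
      \forall x \near p, chi x = 1].
Proof.
move=> oO Op; have /nbhs_ballP[r /= r0 pO] := open_nbhs_nbhs (conj oO Op).
(* q x <= 1 gives a squared distance at most 2 / a = r^2 / 2, inside the ball. *)
pose a := 4 / r ^+ 2.
pose q (x : 'rV[R]_n) := a * (\sum_(i < n) (x 0 i - p 0 i) ^+ 2) - 1.
have qS : smooth_on setT q.
  have cS b : smooth_on [set: 'rV[R]_n] (cst b) by exact: smooth_on_cst openT b.
  pose d i : 'rV[R]_n -> R := (fun x : 'rV[R]_n => x 0 i) + cst (- p 0 i).
  have dS i : smooth_on setT (d i).
    rewrite /d; apply: smooth_onD; [exact: openT| |exact: cS].
    by apply: smooth_on_coord; exact: openT.
  have sS : smooth_on setT (\sum_(i < n) d i * d i).
    apply: smooth_on_sum => [|i]; first exact: openT.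
    by apply: smooth_onM => //; exact: openT.
  suff : smooth_on setT (cst a * (\sum_(i < n) d i * d i) + cst (- 1)).
    by apply: eq_smooth_on => [|x _]; [exact: openT|rewrite !fctE fct_sumE].
  apply: smooth_onD => //; first exact: openT.
  by apply: smooth_onM => //; exact: openT.
have qc : continuous q.
  move=> x; apply: differentiable_continuous.
  exact: smooth_on_differentiable qS _.
exists (fun x => plateau (q x)), [set x | q x <= 1]; split.
- exact: smooth_on_plateau openT qS.
- exact: (closed_comp (fun x _ => qc x) (@closed_le R 1)).
- move=> x /=; rewrite /q => qx; apply: pO; split=> // i j.
  rewrite ord1 /ball /= distrC; rewrite -(@ltr_pXn2r _ 2)// ?nnegrE ?(ltW r0)//.
  rewrite real_normK ?num_real//.
  have le1 : (x 0 j - p 0 j) ^+ 2 <= \sum_(i < n) (x 0 i - p 0 i) ^+ 2.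
    by rewrite (bigD1 j)//= lerDl sumr_ge0// => k _; exact: sqr_ge0.
  have r20 : 0 < r ^+ 2 by rewrite exprn_gt0.
  apply: le_lt_trans le1 _; set s := \sum_(_ < _) _ in qx *.
  have : s <= r ^+ 2 / 2.
    have -> : s = (r ^+ 2 / 4) * (a * s) by rewrite /a; field; rewrite gt_eqF.
    have : a * s <= 2 by lra.
    by nra.
  by lra.

- by move=> x /= /negP; rewrite -ltNge => /ltW/plateau_ge1.
- have qp : q p < 0; last first.
    by apply: filterS (@cvgr_lt _ _ _ _ _ _ (qc p) _ qp) => x /ltW/plateau_le0.
  by rewrite /q big1 ?mulr0 ?sub0r ?ltrN10// => i _; rewrite subrr expr0n.
Qed.

(** Multiply by a bump whose support is a closed subset of [O]: smoothness holds
on [O] and, trivially, on the complement of the support. *)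
Lemma exists_cutoff p O f : open O -> O p -> smooth_on O f ->
  exists g : 'rV[R]_n -> R,
  [/\ smooth_on setT g, (forall x, ~ O x -> g x = 0) & {near p, g =1 f}].
Proof.
move=> oO Op fO; have [chi [C [chiS cC CO chi0 chi1]]] := exists_bump oO Op.
exists (chi * f); split.
- have oC : open (~` C) by exact: closed_openC.
  have -> : setT = O `|` ~` C.
    apply/esym; rewrite -subTset => x _.
    by have [/CO|] := pselect (C x); [left|right].
  apply: smooth_on_union.
    by apply: smooth_onM => //; exact: smooth_onS chiS.
  apply: eq_smooth_on (smooth_on_cst oC 0) => // x Cx.
  by rewrite !fctE chi0 ?mul0r.
- by move=> x Ox; rewrite !fctE chi0 ?mul0r// => /CO.
- by apply: filterS chi1 => x chix; rewrite !fctE chix mul1r.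
Qed.

End Cutoff.

(** * General topology *)

Section GeneralTopology.
Context {T : topologicalType}.

Lemma hausdorff_separate_closure (x y : T) : hausdorff_space T -> x != y ->
  exists W, [/\ open W, W y & ~ closure W x].
Proof.
rewrite open_hausdorff => /[apply] -[[A B] /= [/set_mem Ax /set_mem By]].
move=> [oA oB /eqP AB0]; exists B; split=> // Bx.
have := Bx A (open_nbhs_nbhs (conj oA Ax)).
by rewrite setIC AB0 => -[].
Qed.

(** Cover the space by [U] and by open sets whose closure misses [x], and refine.
Near [x] only finitely many members of the refinement matter, and those not
contained in [U] stay away from [x]. *)
Lemma paracompact_regular : paracompact T -> hausdorff_space T -> regular_space T.
Proof.
move=> pT hT x U0 xU0.
have [U [oU Ux] UU0] : exists2 U, open_nbhs x U & U `<=` U0.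
  by rewrite nbhsE in xU0.
pose C := [set W : set T | open W /\ (W `<=` U \/ ~ closure W x)].
have [|D [Do Dcov DC lfD]] := pT C (fun W CW => CW.1).
  rewrite -subTset => y _; have [Uy|nUy] := pselect (U y).
    by exists U => //; split=> //; left.
  have /(hausdorff_separate_closure hT)[W [oW Wy Wx]] : x != y.
    by apply/eqP => xy; apply: nUy; rewrite -xy.
  by exists W => //; split=> //; right.
have [N xN finN] := lfD x.
pose K :=
  \bigcup_(M in [set M | (D M /\ M `&` N !=set0) /\ ~ M `<=` U]) closure M.
have cK : closed K.
  apply: closed_bigcup => [|M _]; last exact: closed_closure.
  by apply: sub_finite_set finN => M [].
have Kx : ~ K x.
  move=> [M [[DM _] MU] Mx]; have [W [_ [WU|Wx]] MW] := DC _ DM.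
    exact: MU (subset_trans MW WU).
  exact/Wx/(closureS MW).
exists (N `&` ~` K).
  have xK := open_nbhs_nbhs (conj (closed_openC cK) Kx).
  exact: filterI xN xK.
apply: subset_trans UU0 => y Vy; apply: contrapT => Uy.
have [M DM My] : cover D id y by rewrite Dcov.
have [z [[Nz Kz] Mz]] := Vy M (open_nbhs_nbhs (conj (Do _ DM) My)).
apply: Kz; exists M; last exact: subset_closure.
by split; [split=> //; exists z|move=> /(_ y My)].
Qed.

Lemma finI_from_basis (D : set (set T)) : D `<=` open ->
  (forall x U, nbhs x U -> exists V, [/\ D V, V x & V `<=` U]) ->
  basis (finI_from D id).
Proof.
move=> Do DU; split=> [_ [F /= FD <-]|x U /DU[V [DV Vx VU]]].
  rewrite -closedC setC_bigcap; apply: closed_bigcup => // M FM.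
  by apply: open_closedC; apply: Do; apply/set_mem/FD.
by exists V => //; split=> //; exact: finI_from1.
Qed.

Context {T' : topologicalType} (U : set T) (f : T -> T').

Lemma open_setI_preimage (W : set T') : open U -> {within U, continuous f} ->
  open W -> open (U `&` f @^-1` W).
Proof.
move=> oU; rewrite continuous_open_subspace// => cf oW.
rewrite openE => x [Ux Wfx]; apply: filterI; first exact: open_nbhs_nbhs.
by apply: (cf x (mem_set Ux)); exact: open_nbhs_nbhs.
Qed.

Lemma homeo_onto_image_preimage (V : set T) : homeo_onto_image U f -> open V ->
  exists2 W, open W & forall x, U x -> W (f x) <-> V x.
Proof.
move=> [finj _ /[apply]] -[W oW fUV]; exists W => // x Ux; split=> [Wfx|Vx].
  have [z [Uz Vz] fzx] : (f @` (U `&` V)) (f x).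
    by rewrite fUV; split=> //; exists x.
  by rewrite -(finj z x (mem_set Uz) (mem_set Ux) fzx).
by have [] : (f @` U `&` W) (f x) by rewrite -fUV; exists x.
Qed.

End GeneralTopology.

(** * Smooth functions on an atlas *)

Section SmoothFunctions.
Context {R : realType} {S : topologicalType}.
Implicit Types c : chart R S.

(** The local expression in [c'] is [z |-> g (pr (H (z, 0)))], where [H] is the
ambient diffeomorphism of the compatibility condition. *)
Lemma smooth_transfer c c' x g :
  compatible c' c ->
  open (chart_dom c') -> {within chart_dom c', continuous c'} ->
  chart_dom c x -> chart_dom c' x -> smooth_on setT g ->
  exists2 g', smooth_on setT g' & \forall y \near x, g (c y) = g' (c' y).
Proof.
move=> cc' oc' c'cont cx c'x gS.
have [V [N [Om [Om' [H]]]]] := cc' x c'x cx.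
move=> [[oV Vx _] leN [VO _] [oO _ _ HS _] HE].
have [leN1 leN2] : (chart_dim c' <= N)%N /\ (chart_dim c <= N)%N.
  by move: leN; rewrite geq_max => /andP[].
pose i' := mulmx^~ (pid_mx (chart_dim c')) : 'rV[R]_(chart_dim c') -> 'rV[R]_N.
pose p := mulmx^~ (pid_mx (chart_dim c)) : 'rV[R]_N -> 'rV[R]_(chart_dim c).
have oP : open (i' @^-1` Om).
  apply: open_comp oO => z _; apply: differentiable_continuous.
  apply: differentiable_row => j.
  exact: smooth_on_differentiable (smooth_on_mulmx openT _ j) _.
have gHS : smooth_on (i' @^-1` Om) (fun z => g (p (H (i' z)))).
  apply: (@smooth_on_comp _ _ _ oP _ Om (fun w => g (p (H w))) i') => //.
    apply: (@smooth_on_comp _ _ _ oO _ setT g (fun w => p (H w))) => // j.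
    apply: (@smooth_on_comp _ _ _ oO _ setT (fun w => p w 0 j)) => //.
    exact: (@smooth_on_mulmx _ _ _ openT _ (pid_mx (chart_dim c)) j).
  exact: smooth_on_mulmx.
have [g' [g'S _ g'E]] := exists_cutoff oP (VO x Vx) gHS.
exists g' => //.
have cvgc' : c' y @[y --> x] --> c' x.
  by move: c'cont; rewrite continuous_open_subspace// => /(_ x (mem_set c'x)).
near=> y.
have -> : g' (c' y) = g (p (H (i' (c' y)))) by near: y; exact: cvgc' g'E.
rewrite /i' HE; last by near: y; exact: open_nbhs_nbhs.
by rewrite /p -mulmxA pid_mx_id// pid_mx_1 mulmx1.
Unshelve. all: by end_near. Qed.

End SmoothFunctions.

Section Atlas.
Context {R : realType} {S : topologicalType}.
Implicit Types c : chart R S.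
Context (strata : set (set S)) (mfd : set S -> set (chart R S)).
Context (A : set (chart R S)) (hA : smooth_atlas strata mfd A).

Let chart_open c : A c -> open (chart_dom c).
Proof. by move=> Ac; have [cA _ _] := hA; have [oc hc _] := cA _ Ac. Qed.

Let chart_homeo c : A c -> homeo_onto_image (chart_dom c) c.
Proof. by move=> Ac; have [cA _ _] := hA; have [oc hc _] := cA _ Ac. Qed.

Let chart_cvg c x : A c -> chart_dom c x -> c y @[y --> x] --> c x.
Proof.
move=> Ac cx; have [_ + _] := chart_homeo Ac.
rewrite continuous_open_subspace; last exact: chart_open.
by move=> /(_ x (mem_set cx)).
Qed.

Let chart_near c x : A c -> chart_dom c x -> nbhs x (chart_dom c).
Proof. by move=> Ac cx; apply: open_nbhs_nbhs; split=> //; exact: chart_open. Qed.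

Let atlas_cover x : exists2 c, A c & chart_dom c x.
Proof.
have [_ Acov _] := hA; have : [set: S] x by [].
by rewrite -Acov => -[c]; exists c.
Qed.

(** By [smooth_transfer], a local expression in one chart yields one in every
other chart around the same point, and it makes the function continuous. *)
Lemma smooth_functionsP (f : S -> R) :
  (forall x, exists c (g : 'rV[R]_(chart_dim c) -> R),
     [/\ A c, chart_dom c x, smooth_on setT g &
         \forall y \near x, f y = g (c y)]) ->
  smooth_functions A f.
Proof.
move=> fA; split=> [x|c' x Ac' c'x].
  have [c [g [Ac cx gS fg]]] := fA x.
  have gcx : g (c y) @[y --> x] --> f x.
    rewrite (nbhs_singleton fg); apply: continuous_comp (chart_cvg Ac cx) _.
    by apply: differentiable_continuous; exact: smooth_on_differentiable gS _.
  by apply: cvg_trans gcx; apply: near_eq_cvg; apply: filterS fg => y ->.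
have [c [g [Ac cx gS fg]]] := fA x; have [_ _ Acomp] := hA.
have [_ cc' _] := chart_homeo Ac'.
have [g' g'S gg'] :=
  smooth_transfer (Acomp _ _ Ac' Ac) (chart_open Ac') cc' cx c'x gS.
exists (chart_dom c' `&`
  ([set y | f y = g (c y)] `&` [set y | g (c y) = g' (c' y)])), g'.
split=> //; first by apply: filterI; [exact: chart_near|exact: filterI].
by move=> y [_ [/= -> ->]].
Qed.

Lemma smooth_functions_near (f : S -> R) c x : smooth_functions A f ->
  A c -> chart_dom c x ->
  exists2 g, smooth_on setT g & \forall y \near x, f y = g (c y).
Proof.
move=> [_ fA] Ac cx; have [V [g [xV _ gS fg]]] := fA c x Ac cx.
by exists g => //; exact: filterS xV.
Qed.

Context (regS : regular_space S).

(** Cut [g] off inside an open [W] such that [c y] lies in [W] exactly when [y]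
lies in the interior of [V], where the closure of [V] is contained in [U] and in
the chart.  The extension by zero is then zero on the complement of that
closure, which is open and covers everything outside the chart. *)
Lemma smooth_functions_extension c x U g : A c -> chart_dom c x -> nbhs x U ->
  smooth_on setT g ->
  exists h, [/\ smooth_functions A h, \forall y \near x, h y = g (c y) &
                forall y, ~ U y -> h y = 0].
Proof.
move=> Ac cx xU gS.
have [V xV VU] : filter_from (nbhs x) closure (chart_dom c `&` U).
  by apply: regS; apply: filterI => //; exact: chart_near.
have [W oW WV] := homeo_onto_image_preimage (chart_homeo Ac) (open_interior V).
have Wcx : W (c x) by apply/WV.
have [G [GS G0 Gg]] := exists_cutoff oW Wcx (smooth_onS (@subsetT _ W) gS).
pose h y : R := if pselect (chart_dom c y) then G (c y) else 0.
have hG y : chart_dom c y -> h y = G (c y) by rewrite /h; case: pselect.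
have h0 y : ~ V y -> h y = 0.
  rewrite /h; case: pselect => // cy nVy; apply: G0 => /(WV _ cy).
  by move=> /interior_subset.
exists h; split.
- apply: smooth_functionsP => y; have [cy|ncy] := pselect (chart_dom c y).
    by exists c, G; split=> //; apply: filterS (chart_near Ac cy).
  have [c' Ac' c'y] := atlas_cover y; exists c', (cst 0); split=> //.
    exact: smooth_on_cst openT _.
  have : nbhs y (~` closure V).
    apply: open_nbhs_nbhs; split; first exact: closed_openC (@closed_closure _ _).
    by move=> /VU[].
  by apply: filterS => z nVz; apply: h0 => /subset_closure.
- have Ggc : \forall y \near x, G (c y) = g (c y) by have := chart_cvg Ac cx Gg.
  near=> y; rewrite hG; first by near: y.
  by near: y; exact: chart_near.
- by move=> y nUy; apply: h0 => /subset_closure/VU[].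
Unshelve. all: by end_near. Qed.

(** The sub-basis axiom holds because each point has a smooth function equal to 1
there and to 0 off a given neighbourhood. *)
Lemma smooth_functions_differential_structure :
  differential_structure (smooth_functions A).
Proof.
split=> [|n f F fA FS|f fA].
- apply: finI_from_basis => [_ [f [a [b [[cf _] ->]]]]|x U xU].
    by move/continuousP : cf; apply; exact: interval_open.
  have [c Ac cx] := atlas_cover x.
  have [h [hA' hx h0]] :=
    smooth_functions_extension Ac cx xU (smooth_on_cst openT 1).
  exists (h @^-1` `]1/2, 3/2[); split.
  + by exists h, (1/2), (3/2).
  + by rewrite /= (nbhs_singleton hx) /cst in_itv/=; apply/andP; split; lra.
  + move=> y /= hy; apply: contrapT => /h0 hy0.
    by move: hy; rewrite hy0 in_itv/= => /andP[]; lra.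
- apply: smooth_functionsP => x; have [c Ac cx] := atlas_cover x.
  have /choice[g gE] : forall i, exists g : 'rV[R]_(chart_dim c) -> R,
      smooth_on setT g /\ \forall y \near x, f i y = g (c y).
    by move=> i; have [g] := smooth_functions_near (fA i) Ac cx; exists g.
  exists c, (fun z => F (\row_i g i z)); split=> //.
    apply: (@smooth_on_comp _ _ _ openT _ setT F (fun z => \row_i g i z)) => // j.
    by apply: eq_smooth_on (gE j).1 => [|z _]; [exact: openT|rewrite mxE].
  have : \forall y \near x, forall i, f i y = g i (c y).
    by apply: filter_forall => i; exact: (gE i).2.
  by apply: filterS => y fg; congr F; apply/rowP => i; rewrite !mxE fg.
- apply: smooth_functionsP => x; have [c Ac cx] := atlas_cover x.
  have [U [fx [oU Ux fxA ffx]]] := fA x.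
  have [g gS fxg] := smooth_functions_near fxA Ac cx.
  exists c, g; split=> //; near=> y; rewrite ffx; first by near: y.
  by near: y; exact: open_nbhs_nbhs.
Unshelve. all: by end_near. Qed.

(** Pulling back along [c] uses the extension lemma, pushing forward uses the
local expressions in [c]. *)
Lemma chart_diffeomorphic c : A c ->
  diffeomorphic (@diff_subspace R S (smooth_functions A) (chart_dom c))
    (@diff_subspace R _ [set g | smooth_on setT g] (c @` chart_dom c)).
Proof.
move=> Ac; have chc := chart_homeo Ac; have [cinj cc _] := chc.
set U := chart_dom c; set Z := c @` U.
have Zc (u : U) : c (set_val u) \in Z.
  by apply/mem_set; exists (set_val u) => //; exact: set_valP.
pose phi (u : U) : Z := exist _ (c (set_val u)) (Zc u).
have /choice[psi psiE] (z : Z) : exists u : U, c (set_val u) = set_val z.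
  by have [u Uu cu] := set_valP z; exists (exist _ u (mem_set Uu)).
have phiK : cancel phi psi.
  move=> u; apply: val_inj; apply: cinj; [exact: valP|exact: valP|].
  by have := psiE (phi u); rewrite !set_valE.
have psiK : cancel psi phi by move=> z; apply: val_inj; exact: psiE.
exists phi, psi; split=> //.
- split.
    apply: continuous_comp_initial.
    exact/subspace_sigL_continuousP.
  apply: continuous_comp_initial; apply/continuousP => V oV.
  have [W oW WV] := homeo_onto_image_preimage chc oV.
  exists W => //; apply/seteqP; split=> z /=; rewrite -psiE.
    by move=> /(WV _ (set_valP _)).
  by move=> ?; apply/(WV _ (set_valP _)).
- move=> f fZ u; have [W [g [oW Wcu gS fg]]] := fZ (phi u).
  have Uu := set_valP u.
  have [h [hA' hg _]] := smooth_functions_extension Ac Uu filterT gS.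
  pose V := [set y | h y = g (c y)]°.
  exists ((U `&` c @^-1` W) `&` V), h; split=> //.
    apply: openI; last exact: open_interior.
    exact: open_setI_preimage (chart_open Ac) cc oW.
  move=> y [[_ Wy] /interior_subset/= hy]; rewrite /= fg//; exact/esym.
- move=> h hU z; have [V [f [oV Vz fA hf]]] := hU (psi z).
  have [g gS fg] := smooth_functions_near fA Ac (set_valP (psi z)).
  pose V' := [set y | f y = g (c y)].
  have [W oW WV] := homeo_onto_image_preimage chc (openI oV (open_interior V')).
  exists W, g; split=> //; first by rewrite -psiE; apply/(WV _ (set_valP _)).
  move=> y; rewrite -psiE => /(WV _ (set_valP _))[Vy /interior_subset/= fy].
  by rewrite /= hf.
Qed.

End Atlas.

Theorem theorem6 (R : realType) (S : topologicalType)
    (strata : set (set S)) (mfd : set S -> set (chart R S))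
    (atlas : set (chart R S)) :
  paracompact S -> hausdorff_space S -> @second_countable S ->
  stratification strata mfd ->
  smooth_structure strata mfd atlas ->
  subcartesian (smooth_functions atlas).
Proof.
move=> pS hS _ _ [hA _]; have regS := paracompact_regular pS hS.
split=> //; first exact: smooth_functions_differential_structure hA regS.
move=> x; have [cA Acov _] := hA.
have [c Ac cx] : (\bigcup_(c in atlas) chart_dom c) x by rewrite Acov.
exists (chart_dom c), (chart_dim c), (c @` chart_dom c); split=> //.
  by have [] := cA _ Ac.
exact: chart_diffeomorphic hA regS _ Ac.
Qed.
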